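(* $$F_{1\text{-}23}(x,y)=1+xF_{1\text{-}23}(x,y)+\sum_{d\ge 1}x^{d+1}y^{\binom d2}F_{1\text{-}23}(x,y)\prod_{j=0}^{d-1}F_{1\text{-}23}(xy^j,y).$$
   Context: An occurrence of the generalized pattern $1\text{-}23$ in $\pi=\pi_1\cdots\pi_n\in S_n$ is a pair of positions $a<b$ with $b+1\le n$ and $\pi_a<\pi_b<\pi_{b+1}$ (the letters playing the roles of 2 and 3 must be adjacent). A permutation is $1\text{-}3\text{-}2$-avoiding if there are no positions $a<b<c$ with $\pi_a<\pi_c<\pi_b$. $f_{\tau;r}(n)$ is the number of $1\text{-}3\text{-}2$-avoiding permutations in $S_n$ containing exactly $r$ occurrences of $\tau$ (with $S_0$ consisting of the empty permutation), and $F_\tau(x,y)=\sum_{n,r\ge 0} f_{\tau;r}(n)x^ny^r$, a formal power series in $x$ with coefficients in $\mathbb Z[y]$. The convention $\binom12=0$ is used. *)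

(* Defs.v *)
From HB Require Import structures.
From mathcomp Require Import all_boot all_order all_algebra all_fingroup.
From mathcomp Require Import boolp.

Set Implicit Arguments.
Unset Strict Implicit.
Unset Printing Implicit Defensive.

Import GRing.Theory.
Local Open Scope ring_scope.

(* Formal power series in one variable x over R. A record rather than a bare
   function type, so that the product is the Cauchy product and not the
   pointwise one. *)
Record fps (R : comNzRingType) := FPS { fps_coef : nat -> R }.

Section FpsRing.
Variable R : comNzRingType.
Implicit Types f g h : fps R.

HB.instance Definition _ := gen_eqMixin (fps R).
HB.instance Definition _ := gen_choiceMixin (fps R).

Lemma fpsP f g : fps_coef f =1 fps_coef g <-> f = g.
Proof.
split=> [|->//]; case: f => f; case: g => g /= fg.
by congr FPS; apply/funext.
Qed.

Definition fps_zero : fps R := FPS (fun _ => 0).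
Definition fps_one : fps R := FPS (fun n => (n == 0%N)%:R).
Definition fps_opp f : fps R := FPS (fun n => - fps_coef f n).
Definition fps_add f g : fps R := FPS (fun n => fps_coef f n + fps_coef g n).
Definition fps_mul f g : fps R :=
  FPS (fun n => \sum_(i < n.+1) fps_coef f i * fps_coef g (n - i)).

Fact fps_addA : associative fps_add.
Proof. by move=> f g h; apply/fpsP => n /=; rewrite addrA. Qed.

Fact fps_addC : commutative fps_add.
Proof. by move=> f g; apply/fpsP => n /=; rewrite addrC. Qed.

Fact fps_add0 : left_id fps_zero fps_add.
Proof. by move=> f; apply/fpsP => n /=; rewrite add0r. Qed.

Fact fps_addN : left_inverse fps_zero fps_opp fps_add.
Proof. by move=> f; apply/fpsP => n /=; rewrite addNr. Qed.

HB.instance Definition _ := GRing.isZmodule.Build (fps R)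
  fps_addA fps_addC fps_add0 fps_addN.

Definition fps_trunc m f : {poly R} := \poly_(i < m) fps_coef f i.

Lemma coef_fps_mul f g m n : (n < m)%N ->
  fps_coef (fps_mul f g) n = (fps_trunc m f * fps_trunc m g)`_n.
Proof.
move=> nm; rewrite coefM /=; apply: eq_bigr => i _.
rewrite !coef_poly (leq_ltn_trans _ nm) ?(leq_ltn_trans _ nm) ?leq_subr //.
by rewrite -ltnS.
Qed.

Fact fps_mulA : associative fps_mul.
Proof.
move=> f g h; apply/fpsP => n; pose t := fps_trunc n.+1.
have tM u v i : (i <= n)%N -> (t (fps_mul u v))`_i = (t u * t v)`_i.
  by move=> le_in; rewrite coef_poly ltnS le_in -(@coef_fps_mul _ _ n.+1).
rewrite (@coef_fps_mul f _ n.+1) // (@coef_fps_mul _ h n.+1) // -/t.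
transitivity ((t f * (t g * t h))`_n).
  by rewrite !coefM; apply: eq_bigr => i _; rewrite tM // leq_subr.
by rewrite mulrA !coefM; apply: eq_bigr => i _; rewrite tM // -ltnS.
Qed.

Fact fps_mulC : commutative fps_mul.
Proof.
by move=> f g; apply/fpsP => n; rewrite !(@coef_fps_mul _ _ n.+1) // mulrC.
Qed.

Fact fps_mul1 : left_id fps_one fps_mul.
Proof.
move=> f; apply/fpsP => n /=; rewrite big_ord_recl /= mul1r subn0 big1 ?addr0 //.
by move=> i _; rewrite mul0r.
Qed.

Fact fps_mulDl : left_distributive fps_mul fps_add.
Proof.
move=> f g h; apply/fpsP => n /=; rewrite -big_split /=.
by apply: eq_bigr => i _; rewrite mulrDl.
Qed.

Fact fps_one_neq0 : fps_one != 0.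
Proof.
by apply/eqP => /fpsP /(_ 0%N) /= /eqP; rewrite oner_eq0.
Qed.

HB.instance Definition _ := GRing.Zmodule_isComNzRing.Build (fps R)
  fps_mulA fps_mulC fps_mul1 fps_mulDl fps_one_neq0.

Definition fpsX : fps R := FPS (fun n => (n == 1%N)%:R).

Definition fpsC (c : R) : fps R := FPS (fun n => if n == 0%N then c else 0).

(* The substitution f(x) |-> f(x * c) for a scalar c. *)
Definition fps_scalex (c : R) f : fps R := FPS (fun n => fps_coef f n * c ^+ n).

(* x-adic convergence: each coefficient is eventually constant. *)
Definition fps_cvg (u : nat -> fps R) (s : fps R) : Prop :=
  forall n, exists N, forall M, (N <= M)%N -> fps_coef (u M) n = fps_coef s n.

Lemma fps_cvg_unique u s t : fps_cvg u s -> fps_cvg u t -> s = t.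
Proof.
move=> us ut; apply/fpsP => n; have [N1 h1] := us n; have [N2 h2] := ut n.
by rewrite -(h1 (maxn N1 N2)) ?leq_maxl // -(h2 (maxn N1 N2)) ?leq_maxr.
Qed.

(* [fps_series m u s]: the infinite sum of the u d over d >= m is s. *)
Definition fps_series (m : nat) (u : nat -> fps R) (s : fps R) : Prop :=
  fps_cvg (fun M => \sum_(m <= d < M) u d) s.

End FpsRing.

Arguments fpsX {R}.

(* A permutation s : 'S_n is read as the word s 0, s 1, ..., s (n - 1). *)
Definition avoids132 (n : nat) (s : 'S_n) : bool :=
  ~~ [exists a : 'I_n, exists b : 'I_n, exists c : 'I_n,
        [&& (a < b)%N, (b < c)%N, (s a < s c)%N & (s c < s b)%N]].

Definition occ_1_23 (n : nat) (s : 'S_n) : nat :=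
  #|[set ab : 'I_n * 'I_n | (ab.1 < ab.2)%N &&
      [exists c : 'I_n, [&& c == ab.2.+1 :> nat,
                           (s ab.1 < s ab.2)%N & (s ab.2 < s c)%N]]]|.

Definition f_1_23 (r n : nat) : nat :=
  #|[set s : 'S_n | avoids132 s & occ_1_23 s == r]|.

(* In {poly int} the indeterminate 'X is y. The bound r <= n ^ 2 loses nothing:
   see coef_F_1_23. *)
Definition F_1_23 : fps {poly int} :=
  FPS (fun n => \poly_(r < (n ^ 2).+1) (f_1_23 r n)%:Z).

Lemma occ_1_23_le (n : nat) (s : 'S_n) : (occ_1_23 s <= n ^ 2)%N.
Proof. by rewrite (leq_trans (max_card _)) // card_prod card_ord mulnn. Qed.

Lemma coef_F_1_23 (n r : nat) : (fps_coef F_1_23 n)`_r = (f_1_23 r n)%:Z.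
Proof.
rewrite coef_poly; case: ltnP => // lt_r; congr Posz; apply/esym/eqP.
rewrite cards_eq0; apply/eqP/setP => s; rewrite !inE; apply/negP => /andP[_ /eqP e].
by have := occ_1_23_le s; rewrite e leqNgt lt_r.
Qed.

(* Main.v *)
(* Split a nonempty 132-avoiding word at its last letter k: every letter above k
   precedes every letter below k, so the word is u v k with u > k > v, and
   (u, v) ranges freely over pairs of 132-avoiders. Let e(w) count the letters of
   w below its last letter, so e(u v k) = |v|. Appending k to v creates e(v)
   occurrences of 1-23, hence occ(u v k) = occ u + occ v + e(v). With G the
   generating function of 132-avoiders weighted by y^(occ + e), this reads
   F = 1 + x F G and G(x) = 1 + x F(x) G(xy); iterating the second equation
   expands G as the sum of x^d y^(d choose 2) \prod_(j < d) F(x y^j). *)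

Require Import Defs.
From mathcomp Require Import all_boot all_order all_algebra all_fingroup.
From mathcomp Require Import ring.

Import GRing.Theory.
Local Open Scope ring_scope.

(** * Pattern statistics on words and their behaviour under concatenation *)

Fixpoint av132 (w : seq nat) : bool :=
  if w is a :: v then av132 v && pairwise (fun b c => ~~ (a < c < b)%N) v
  else true.

(** Occurrences are grouped by the position [b] of the letter playing 2; the bound [(size w).-1]
    keeps [b.+1] inside the word. *)
Definition occ123 (w : seq nat) : nat :=
  (\sum_(b < (size w).-1)
     (nth 0 w b < nth 0 w b.+1) * count (gtn (nth 0 w b)) (take b w))%N.

Definition below_last (w : seq nat) : nat := count (gtn (last 0%N w)) w.

Lemma below_last_rcons w x : below_last (rcons w x) = count (gtn x) w.
Proof. by rewrite /below_last last_rcons -cats1 count_cat /= ltnn !addn0. Qed.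

(** A new occurrence must use [x] as its 3, hence the old last letter as its 2, and any smaller
    letter of [w] as its 1. For empty [w] the default value of [last] is harmless, since
    [below_last] is then 0. *)
Lemma occ123_rcons w x :
  occ123 (rcons w x) = (occ123 w + (last 0 w < x) * below_last w)%N.
Proof.
rewrite /occ123 size_rcons /=; case: (lastP w) => [|v y].
  by rewrite /= !big_ord0 muln0.
rewrite below_last_rcons last_rcons size_rcons /= big_ord_recr /=; congr (_ + _)%N.
  apply: eq_bigr => b _; have ltb := ltn_ord b.
  rewrite -(cats1 (rcons v y)) !nth_cat size_rcons !ltnS ltb (ltnW ltb).
  by rewrite takel_cat // size_rcons ltnW // ltnW.
rewrite !nth_rcons size_rcons ltnSn ltnn eqxx ltnn eqxx.
by rewrite -!cats1 -catA take_size_cat.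
Qed.

Lemma below_last_map_addn k w : below_last (map (addn k) w) = below_last w.
Proof.
case: (lastP w) => [|v x] //; rewrite map_rcons !below_last_rcons count_map.
by apply: eq_count => y /=; rewrite ltn_add2l.
Qed.

Lemma occ123_map_addn k w : occ123 (map (addn k) w) = occ123 w.
Proof.
elim/last_ind: w => [|w x IHw] //.
rewrite map_rcons !occ123_rcons IHw below_last_map_addn; congr (_ + _)%N.
by case: (lastP w) => [|v y]; rewrite ?muln0 // map_rcons !last_rcons ltn_add2l.
Qed.

(** The junction is a descent, so it cannot carry 23, and no letter of [u] is small enough to play 1
    for two letters of [v]. *)
Lemma occ123_cat u v : allrel gtn u v -> occ123 (u ++ v) = (occ123 u + occ123 v)%N.
Proof.
elim/last_ind: v => [|v x IHv]; first by rewrite cats0 {3}/occ123 big_ord0 addn0.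
rewrite -cats1 allrel_catr allrel1r cats1 => /andP[uv ux].
rewrite -rcons_cat !occ123_rcons IHv // -addnA; congr (_ + (_ + _))%N.
case: (lastP v) uv => [|v' y] uv.
  rewrite cats0 /= muln0; case: (lastP u) ux => [|u' z]; first by rewrite muln0.
  by rewrite all_rcons /= last_rcons => /andP[zx _]; rewrite ltnNge ltnW.
rewrite -rcons_cat !last_rcons !below_last_rcons count_cat; congr (_ * _)%N.
rewrite (@eq_in_count _ _ pred0) ?count_pred0 // => z zu /=.
have /allrelP/(_ z y zu) := uv.
by rewrite mem_rcons inE eqxx => /(_ isT) /= yz; rewrite ltnNge ltnW.
Qed.

(** A 132 straddling the cut would have its 1 in [u] and its 2 in [v], but letters of [u] exceed
    those of [v]. *)
Lemma av132_cat u v : allrel gtn u v -> av132 (u ++ v) = av132 u && av132 v.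
Proof.
elim: u => [|a u IHu] //=; rewrite allrel_consl => /andP[av uv].
rewrite IHu // pairwise_cat.
have -> : pairwise (fun b c => ~~ (a < c < b)%N) v.
  apply/(pairwiseP 0%N) => i j _ jv _.
  by have /= := all_nthP 0%N av j jv => /ltnW le_ja; rewrite ltnNge le_ja.
have -> : allrel (fun b c => ~~ (a < c < b)%N) u v.
  apply/allrelP => b c _ cv.
  by have /= := allP av c cv => /ltnW le_ca; rewrite ltnNge le_ca.
by rewrite andbT andbAC.
Qed.

Lemma av132_rcons_max v x : all (gtn x) v -> av132 (rcons v x) = av132 v.
Proof.
elim: v => [|a v IHv] //= /andP[ax vx]; rewrite IHv // pairwise_rcons.
congr (_ && _); apply: andb_idl => _; apply/allP => b /(allP vx) /= bx.
by rewrite [(x < b)%N]ltnNge (ltnW bx) andbF.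
Qed.

Lemma av132_map_addn k v : av132 (map (addn k) v) = av132 v.
Proof.
elim: v => [|a v IHv] //=; rewrite IHv pairwise_map; congr (_ && _).
by apply: eq_pairwise => b c /=; rewrite !ltn_add2l.
Qed.

(* A letter smaller than the last letter k followed by one larger than k
   would form 132 with k. *)
Lemma av132_rcons_split v k : av132 (rcons v k) -> k \notin v ->
  v = filter (ltn k) v ++ filter (gtn k) v.
Proof.
elim: v => [|a v IHv] //=; rewrite inE negb_or pairwise_rcons.
move=> /andP[av_v /andP[/allP ak _]] /andP[ka kv].
case: ltnP => [lt_ka | le_ak].
  by rewrite ltnNge ltnW //= -IHv.
have lt_ak : (a < k)%N by rewrite ltn_neqAle eq_sym ka.
rewrite lt_ak.
have vk : all (gtn k) v.
  apply/allP => b bv /=; have := ak b bv; rewrite lt_ak -leqNgt /= => le_bk.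
  by rewrite ltn_neqAle le_bk andbT; apply: contraNneq kv => <-.
rewrite (eq_in_filter (a2 := pred0)) ?filter_pred0 /=; last first.
  by move=> b /(allP vk) /= bk; rewrite ltnNge ltnW.
by congr cons; apply/esym/all_filterP.
Qed.

(** * Decomposition of avoiders at the last letter *)

Definition av132_words n : seq (seq nat) := filter av132 (permutations (iota 0 n)).

Lemma mem_av132_words n w : (w \in av132_words n) = av132 w && perm_eq w (iota 0 n).
Proof. by rewrite mem_filter mem_permutations. Qed.

(** The word u v k, where u is given in standardised form: the shift by [k.+1] lifts its letters
    just above [k]. *)
Definition glue k (p : seq nat * seq nat) : seq nat :=
  map (addn k.+1) p.1 ++ rcons p.2 k.

Lemma glue_above k (u v : seq nat) : all (gtn k) v ->
  allrel gtn (map (addn k.+1) u) (rcons v k).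
Proof.
move=> vk; apply/allrelP => _ y /mapP[x _ ->]; rewrite mem_rcons inE /= addSn.
by case/predU1P=> [-> | /(allP vk) /ltnW yk]; rewrite ltnS ?leq_addr ?(leq_trans yk) ?leq_addr.
Qed.

Lemma perm_iota_gtn {v : seq nat} {k} : perm_eq v (iota 0 k) -> all (gtn k) v.
Proof. by move=> /perm_mem vk; apply/allP => x; rewrite vk mem_iota. Qed.

Lemma occ123_glue k u v : all (gtn k) v ->
  occ123 (glue k (u, v)) = (occ123 u + (occ123 v + below_last v))%N.
Proof.
move=> vk; rewrite /glue occ123_cat ?glue_above // occ123_map_addn occ123_rcons.
(* For nonempty [v], its last letter is below [k], so appending [k] creates an ascent; for empty [v]
   both sides contribute 0. *)
congr (_ + (_ + _))%N; case: (lastP v) vk => [|v' y]; rewrite ?muln0 //.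
by rewrite all_rcons last_rcons => /andP[/= -> _]; rewrite mul1n.
Qed.

Lemma below_last_glue k u v : all (gtn k) v -> below_last (glue k (u, v)) = size v.
Proof.
move=> vk; rewrite /glue /= -rcons_cat below_last_rcons count_cat.
move: (vk); rewrite all_count => /eqP->.
rewrite (@eq_in_count _ _ pred0) ?count_pred0 // => _ /mapP[x _ ->] /=.
by rewrite addSn ltnNge ltnW // ltnS leq_addr.
Qed.

(** This is the bijection between avoiders ending in [k] and pairs of smaller avoiders. Both lists
    are duplicate-free, so it suffices to compare their members. *)
Lemma av132_words_last n k : (k <= n)%N ->
  perm_eq [seq w <- av132_words n.+1 | last 0%N w == k]
          [seq glue k (u, v) | u <- av132_words (n - k), v <- av132_words k].
Proof.
move=> le_kn.
have iotaE : iota 0 n.+1 = iota 0 k ++ k :: map (addn k.+1) (iota 0 (n - k)).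
  by rewrite -iotaDl addn0 -[k :: _]/(iota k (n - k).+1) -iotaD -subSn // subnKC // leqW.
apply: uniq_perm.
- by rewrite !filter_uniq // permutations_uniq.
- apply: allpairs_uniq; rewrite ?filter_uniq ?permutations_uniq //.
  move=> _ _ /allpairsP[[u v] [/= uP _ ->]] /allpairsP[[u' v'] [/= uP' _ ->]] /=.
  (* Both first components have length [n - k], so equal glued words are cut at the same place. *)
  move: uP uP'; rewrite !mem_av132_words => /andP[_ /perm_size su] /andP[_ /perm_size su'].
  move=> /eqP; rewrite /glue /= eqseq_cat ?size_map ?su ?su' // => /andP[/eqP eu /eqP ev].
  by congr (_, _); [apply: (inj_map (@addnI k.+1) eu) | case/rcons_inj: ev].
move=> w; rewrite mem_filter mem_av132_words; apply/idP/allpairsP.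
  case/andP=> /eqP wk /andP[av_w w_iota].
  case: (lastP w) wk av_w w_iota => [|v k']; first by move=> _ _ /perm_size.
  rewrite last_rcons => ->{k'} av_v v_iota.
  have v_perm : perm_eq v (iota 0 k ++ map (addn k.+1) (iota 0 (n - k))).
    rewrite -(perm_cons k) (perm_trans _ (perm_trans v_iota _)) //.
      by rewrite perm_sym perm_rcons.
    by rewrite iotaE -cat1s perm_catCA.
  have kv : k \notin v.
    by have := perm_uniq v_iota; rewrite iota_uniq rcons_uniq => /andP[].
  have v_split := av132_rcons_split _ _ av_v kv.
  have small : perm_eq (filter (gtn k) v) (iota 0 k).
    rewrite (perm_trans (perm_filter _ v_perm)) // filter_cat.
    rewrite (all_filterP (perm_iota_gtn (perm_refl _))) (eq_in_filter (a2 := pred0)).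
      by rewrite filter_pred0 cats0.
    by move=> _ /mapP[x _ ->] /=; rewrite addSn ltnNge ltnW // ltnS leq_addr.
  have large : perm_eq (filter (ltn k) v) (map (addn k.+1) (iota 0 (n - k))).
    rewrite (perm_trans (perm_filter _ v_perm)) // filter_cat.
    rewrite (eq_in_filter (a2 := pred0)) ?filter_pred0; last first.
      by move=> x; rewrite mem_iota /= => /ltnW; rewrite leqNgt => /negPf.
    rewrite (all_filterP _) //; apply/allP => _ /mapP[x _ ->] /=.
    by rewrite addSn ltnS leq_addr.
  (* Standardise the block of large letters; truncated subtraction is exact there because each
     letter exceeds [k]. *)
  pose u := map (subn^~ k.+1) (filter (ltn k) v).
  have uE : map (addn k.+1) u = filter (ltn k) v.
    rewrite -map_comp map_id_in // => x; rewrite mem_filter /= => /andP[kx _].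
    by rewrite subnKC.
  have glueE : glue k (u, filter (gtn k) v) = rcons v k.
    by rewrite /glue /= uE -rcons_cat -v_split.
  move: av_v; rewrite -glueE /glue av132_cat ?glue_above ?filter_all //=.
  rewrite av132_map_addn av132_rcons_max ?filter_all // => /andP[av_u av_v].
  exists (u, filter (gtn k) v); rewrite !mem_av132_words av_u av_v small.
  split=> //=; apply: (perm_map_inj (@addnI k.+1)).
  by rewrite uE.
(* Conversely, every glued pair is an avoider on the full alphabet ending in [k]. *)
move: (iota 0 n.+1) iotaE => _ -> [[u v] [/= uP vP ->]]; move: uP vP; rewrite !mem_av132_words.
move=> /andP[av_u u_iota] /andP[av_v v_iota]; have vk := perm_iota_gtn v_iota.
rewrite {1}/glue /= last_cat last_rcons eqxx /glue av132_cat ?glue_above //=.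
rewrite av132_map_addn av_u av132_rcons_max // av_v /= -cat_rcons perm_catC.
by rewrite perm_cat ?perm_map // -!cats1 perm_cat.
Qed.

(** * Transfer between permutations and words *)

Definition word {n} (s : 'S_n) : seq nat := [seq val (s i) | i <- enum 'I_n].

Lemma size_word n (s : 'S_n) : size (word s) = n.
Proof. by rewrite size_map size_enum_ord. Qed.

Lemma nth_word n (s : 'S_n) (i : 'I_n) : nth 0%N (word s) i = s i.
Proof. by rewrite (nth_map i) ?size_enum_ord // nth_ord_enum. Qed.

Lemma word_inj n : injective (@word n).
Proof.
by move=> s t st; apply/permP => i; apply: val_inj; rewrite /= -!nth_word st.
Qed.

Lemma word_perm_iota n (s : 'S_n) : perm_eq (word s) (iota 0 n).
Proof.
apply: uniq_perm; rewrite ?iota_uniq //.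
  by rewrite map_inj_uniq ?enum_uniq // => i j /val_inj /perm_inj.
move=> x; rewrite mem_iota /=; apply/mapP/idP => [[i _ ->]| lt_xn]; first exact: ltn_ord.
by exists (s^-1%g (Ordinal lt_xn)); rewrite ?mem_enum // permKV.
Qed.

Lemma av132P w : av132 w <->
  (forall i j l, (i < j < l)%N -> (l < size w)%N ->
     ~~ (nth 0 w i < nth 0 w l < nth 0 w j)%N).
Proof.
elim: w => [|a w IHw] //=; split.
  move=> /andP[/IHw av_w /(pairwiseP 0%N) aw] [|i] [|j] [|l];
    rewrite ?ltn0 ?andbF //= => ijl lw.
    by apply: aw => //; apply: (@ltn_trans l j).
  exact: av_w.
move=> av_aw; apply/andP; split.
  by apply/IHw => i j l ijl lw; apply: (av_aw i.+1 j.+1 l.+1).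
by apply/(pairwiseP 0%N) => j l _ lw jl; apply: (av_aw 0%N j.+1 l.+1).
Qed.

Lemma av132_word n (s : 'S_n) : av132 (word s) = avoids132 s.
Proof.
apply/idP/idP => [/av132P av_s | /negP av_s].
  apply/negP => /existsP[a /existsP[b /existsP[c /and4P[ab bc ac cb]]]].
  have := av_s a b c; rewrite ab bc size_word ltn_ord !nth_word ac cb.
  by move/(_ isT isT).
apply/av132P => i j l /andP[ij jl]; rewrite size_word => ln.
have jn := ltn_trans jl ln; have i_n := ltn_trans ij jn.
rewrite (nth_word _ _ (Ordinal ln)) (nth_word _ _ (Ordinal jn)) (nth_word _ _ (Ordinal i_n)).
apply/negP => /andP[il lj]; apply: av_s.
apply/existsP; exists (Ordinal i_n); apply/existsP; exists (Ordinal jn).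
by apply/existsP; exists (Ordinal ln); rewrite ij jl il.
Qed.

Lemma count_take_word n (s : 'S_n) (p : pred nat) b : (b <= n)%N ->
  count p (take b (word s)) = (\sum_(a < n | a < b) p (s a))%N.
Proof.
move=> le_bn; rewrite -sum1_count (big_nth 0%N) big_mkord size_takel ?size_word //.
rewrite (big_ord_widen_cond n (fun a => p (nth 0%N (take b (word s)) a)) (fun=> 1%N)) //.
rewrite big_mkcondl /=; apply: eq_bigr => a ab.
by rewrite nth_take // nth_word; case: (p _).
Qed.

Lemma occ123_word n (s : 'S_n) : occ123 (word s) = occ_1_23 s.
Proof.
pose P (a b : 'I_n) := (a < b)%N &&
  [exists c : 'I_n, [&& c == b.+1 :> nat, (s a < s b)%N & (s b < s c)%N]].
have PE a b : P a b = [&& (a < b)%N, (b.+1 < n)%N, (s a < s b)%N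
                        & (s b < nth 0 (word s) b.+1)%N].
  rewrite /P; congr andb; apply/existsP/and3P => [[c /and3P[/eqP cb ab bc]] | [bn ab bc]].
    by rewrite -cb ltn_ord nth_word ab bc.
  by exists (Ordinal bn); rewrite eqxx ab /= -(nth_word _ s (Ordinal bn)).
rewrite /occ_1_23 -sum1dep_card big_mkcond /=.
(* Summing over [b] on the outside matches the grouping in [occ123]; the two sides are then compared
   for each [b]. *)
rewrite -(pair_bigA _ (fun a b => if P a b then 1 else 0)%N) exchange_big /=.
rewrite /occ123 size_word; set w := word s.
rewrite (big_ord_widen n (fun b : nat =>
  (nth 0 w b < nth 0 w b.+1) * count (gtn (nth 0 w b)) (take b w))%N); last exact: leq_pred.
rewrite big_mkcond; apply: eq_bigr => b _ /=.
have -> : (b < n.-1)%N = (b.+1 < n)%N by rewrite -ltnS prednK // (leq_trans _ (ltn_ord b)).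
under [RHS]eq_bigr do rewrite PE.
rewrite {}/w nth_word; case: ltnP => _; last by rewrite big1 // => a _; rewrite andbF.
case: ltnP => _; last by rewrite mul0n big1 // => a _; rewrite !andbF.
rewrite mul1n (count_take_word _ _ _ _ (ltnW (ltn_ord b))) big_mkcond.
apply: eq_bigr => a _ /=.
by case: (a < b)%N => //=; rewrite andbT; case: (s a < s b)%N.
Qed.

(** The words of permutations form a duplicate-free sublist, and both lists have n! entries. *)
Lemma perm_word n : perm_eq [seq word s | s : 'S_n] (permutations (iota 0 n)).
Proof.
have word_uniq : uniq [seq word s | s : 'S_n].
  by rewrite map_inj_uniq ?enum_uniq //; apply: word_inj.
have sub : {subset [seq word s | s : 'S_n] <= permutations (iota 0 n)}.
  by move=> _ /mapP[s _ ->]; rewrite mem_permutations word_perm_iota.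
have le_size : (size (permutations (iota 0 n)) <= size [seq word s | s : 'S_n])%N.
  by rewrite size_permutations ?iota_uniq // size_iota size_map -cardE card_Sn.
have [_ eq_mem] := uniq_min_size word_uniq sub le_size.
exact: uniq_perm word_uniq (permutations_uniq _) eq_mem.
Qed.

(** * Weighted enumeration of avoiders *)

Definition weight_sum (wt : seq nat -> nat) n : {poly int} :=
  \sum_(w <- av132_words n) 'X^(wt w).

Lemma coef_F_1_23_words n : fps_coef F_1_23 n = weight_sum occ123 n.
Proof.
rewrite /weight_sum big_filter -(perm_big _ (perm_word n)) big_map big_enum_cond /=.
apply/polyP => r; rewrite coef_F_1_23 /f_1_23 coef_sum -sum1dep_card.
rewrite big_mkcondr /= -natz natr_sum.
apply: eq_big => [s | s _]; first by rewrite av132_word.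
rewrite coefXn occ123_word eq_sym.
by case: eqP.
Qed.

(** One recurrence serves both series: [c k] is the excess of the weight of u v k over occ u + occ v
    + e(v), namely 0 for F and [k] for G. *)
Lemma weight_sum_recr (wt : seq nat -> nat) (c : nat -> nat) n :
  (forall u v k, all (gtn k) v -> size v = k ->
     wt (glue k (u, v)) = (occ123 u + (occ123 v + below_last v + c k))%N) ->
  weight_sum wt n.+1 =
    \sum_(k < n.+1) weight_sum occ123 (n - k) *
       (weight_sum (fun v => occ123 v + below_last v)%N k * 'X^(c k)).
Proof.
move=> wtE; rewrite {1}/weight_sum.
(* Sort the words by last letter, which lies below [n.+1]. *)
transitivity (\sum_(k < n.+1) \sum_(w <- av132_words n.+1 | last 0%N w == k)
   'X^(wt w) : {poly int}).
  rewrite (exchange_big_dep xpredT) //= big_seq [RHS]big_seq; apply: eq_bigr => w.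
  rewrite mem_av132_words => /andP[_ w_iota].
  have lt_wn : (last 0 w < n.+1)%N.
    have /allP := perm_iota_gtn w_iota; apply.
    by case: w w_iota => [/perm_size|x w _] //=; rewrite mem_last.
  by rewrite (big_pred1 (Ordinal lt_wn)) // => k; rewrite eq_sym -val_eqE.
apply: eq_bigr => k _; have le_kn : (k <= n)%N by rewrite -ltnS.
rewrite -big_filter (perm_big _ (av132_words_last n k le_kn)) /=.
rewrite big_allpairs_dep /= /weight_sum mulr_suml big_seq [RHS]big_seq.
apply: eq_bigr => u _; rewrite mulr_suml mulr_sumr big_seq [RHS]big_seq.
apply: eq_bigr => v; rewrite mem_av132_words => /andP[_ v_iota].
rewrite wtE ?perm_iota_gtn // ?(perm_size v_iota) ?size_iota //.
by rewrite !exprD.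
Qed.

Lemma occ123_nil : occ123 [::] = 0%N.
Proof. by rewrite /occ123 big_ord0. Qed.

Lemma weight_sum0 (wt : seq nat -> nat) : wt [::] = 0%N -> weight_sum wt 0 = 1.
Proof. by move=> wt0; rewrite /weight_sum big_seq1 wt0. Qed.

Definition G_1_23 : fps {poly int} :=
  FPS (weight_sum (fun w => occ123 w + below_last w)%N).

(** * Power series: multiplication by x and scaling of the variable *)

Section FpsFacts.
Variable R : comNzRingType.
Implicit Types (f g : fps R) (c d : R).

Lemma fps_coef_add f g n : fps_coef (f + g) n = fps_coef f n + fps_coef g n.
Proof. by []. Qed.

Lemma fps_coefXM f n : fps_coef (fpsX * f) n = if n is m.+1 then fps_coef f m else 0.
Proof.
case: n => [|n] /=; first by rewrite big_ord1 mul0r.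
rewrite big_ord_recl mul0r add0r big_ord_recl mul1r subSS subn0.
by rewrite big1 ?addr0 // => i _; rewrite mul0r.
Qed.

Lemma fps_coefXnM_small m f n : (n < m)%N -> fps_coef (fpsX ^+ m * f) n = 0.
Proof.
elim: m n => // m IHm [|n] lt_nm; rewrite exprS -mulrA fps_coefXM //.
exact: IHm.
Qed.

Lemma fps_scalexM c f g : fps_scalex c (f * g) = fps_scalex c f * fps_scalex c g.
Proof.
apply/fpsP => n /=; rewrite mulr_suml; apply: eq_bigr => i _.
by rewrite mulrACA -exprD subnKC // -ltnS.
Qed.

Lemma fps_scalexD c f g : fps_scalex c (f + g) = fps_scalex c f + fps_scalex c g.
Proof. by apply/fpsP => n /=; rewrite mulrDl. Qed.

Lemma fps_scalex1 c : fps_scalex c 1 = 1.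
Proof. by apply/fpsP => -[|n] /=; rewrite ?mulr1 ?mul0r. Qed.

Lemma fps_scalex_id f : fps_scalex 1 f = f.
Proof. by apply/fpsP => n /=; rewrite expr1n mulr1. Qed.

Lemma fps_scalexA c d f : fps_scalex c (fps_scalex d f) = fps_scalex (d * c) f.
Proof. by apply/fpsP => n /=; rewrite exprMn mulrA. Qed.

Lemma fps_scalexX c : fps_scalex c fpsX = fpsC c * fpsX.
Proof.
rewrite mulrC; apply/fpsP => n; rewrite fps_coefXM /=.
by case: n => [|[|n]] /=; rewrite ?mul0r // mul1r.
Qed.

Lemma fpsCM c d : fpsC (c * d) = fpsC c * fpsC d.
Proof.
apply/fpsP => -[|n] /=; first by rewrite big_ord1.
rewrite big1 // => -[[|i] ltin] _ /=; last by rewrite mul0r.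
by rewrite mulr0.
Qed.

Lemma fpsC1 : fpsC 1 = 1 :> fps R.
Proof. by apply/fpsP => -[|n]. Qed.

End FpsFacts.

(** * Functional equations and their iteration *)

Lemma F_1_23_eq : F_1_23 = 1 + fpsX * F_1_23 * G_1_23.
Proof.
apply/fpsP => n; rewrite fps_coef_add -mulrA fps_coefXM coef_F_1_23_words.
case: n => [|n] /=; first by rewrite addr0 weight_sum0 ?occ123_nil.
rewrite add0r (weight_sum_recr occ123 (fun=> 0%N)) => [|u v k vk _]; last first.
  by rewrite occ123_glue // addn0.
(* The recurrence is indexed by the length of v, the Cauchy product by that of u. *)
rewrite [RHS](reindex_inj rev_ord_inj) /=; apply: eq_bigr => k _.
by rewrite mulr1 -coef_F_1_23_words subSS subKn // -ltnS.
Qed.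

(** Since e(u v k) = |v| = k, the factor for v of length k gains y^k, which turns G(x) into
    G(xy). *)
Lemma G_1_23_eq : G_1_23 = 1 + fpsX * F_1_23 * fps_scalex 'X G_1_23.
Proof.
apply/fpsP => n; rewrite fps_coef_add -mulrA fps_coefXM.
case: n => [|n] /=; first by rewrite addr0 weight_sum0 ?occ123_nil.
rewrite add0r (weight_sum_recr (fun w => occ123 w + below_last w)%N id) => [|u v k vk vs]; last first.
  by rewrite occ123_glue // below_last_glue // vs -addnA.
rewrite [RHS](reindex_inj rev_ord_inj) /=; apply: eq_bigr => k _.
by rewrite -coef_F_1_23_words subSS subKn // -ltnS.
Qed.

Definition unfold_coef d : fps {poly int} :=
  fpsX ^+ d * fpsC ('X ^+ 'C(d, 2)) * \prod_(0 <= j < d) fps_scalex ('X ^+ j) F_1_23.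

Lemma unfold_coef0 : unfold_coef 0 = 1.
Proof. by rewrite /unfold_coef big_geq // bin0n !expr0 fpsC1 !mulr1. Qed.

Lemma G_1_23_unfold M :
  G_1_23 = \sum_(0 <= d < M) unfold_coef d + unfold_coef M * fps_scalex ('X ^+ M) G_1_23.
Proof.
elim: M => [|M IHM].
  by rewrite big_geq // unfold_coef0 add0r expr0 mul1r fps_scalex_id.
rewrite {1}IHM big_nat_recr //= -addrA; congr (_ + _).
(* Apply the equation for G at x y^M inside the remainder: its 1 gives the next term of the sum. *)
rewrite {1}G_1_23_eq fps_scalexD fps_scalex1 mulrDr mulr1; congr (_ + _).
rewrite !fps_scalexM fps_scalexA -exprS fps_scalexX.
(* The scaled x brings a factor y^M, absorbed by Pascal's rule: C(M+1, 2) = C(M, 2) + M. *)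
rewrite /unfold_coef binS bin1 [in RHS]exprD fpsCM big_nat_recr //= (exprS fpsX).
move: (fps_scalex _ G_1_23) (fps_scalex _ F_1_23) (\prod_(_ <= _ < _) _) => g f p.
move: (fpsX ^+ M) (fpsC ('X ^+ 'C(M, 2))) (fpsC ('X ^+ M)) => a b c.
ring.
Qed.

Theorem theorem4p3 :
  exists S : fps {poly int},
    fps_series 1
      (fun d => fpsX ^+ d.+1 * fpsC ('X ^+ 'C(d, 2)) * F_1_23 *
                \prod_(0 <= j < d) fps_scalex ('X ^+ j) F_1_23) S
    /\ F_1_23 = 1 + fpsX * F_1_23 + S.
Proof.
(* The sum starts at d = 1, so the term 1 of G at d = 0 is removed; it accounts for the separate
   summand x F. *)
exists (fpsX * F_1_23 * (G_1_23 - 1)); split; last first.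
  by rewrite mulrBr mulr1 addrACA subrr addr0 -F_1_23_eq.
move=> n; exists n.+1 => M lt_nM.
have M_gt0 : (0 < M)%N by apply: leq_trans lt_nM.
rewrite (eq_bigr (fun d => fpsX * F_1_23 * unfold_coef d)) => [|d _]; last first.
  rewrite exprS /unfold_coef !mulrA; congr (_ * _).
  by rewrite -!mulrA [F_1_23 * _]mulrC -mulrA.
rewrite -mulr_sumr (G_1_23_unfold M) (big_ltn M_gt0).
rewrite unfold_coef0 -(addrA 1) (addrC 1) addrK.
(* The remainder after [M] terms is a multiple of x^M, so it does not reach the coefficient of x^n
   when n < M. *)
rewrite mulrDr fps_coef_add [X in _ = _ + X](_ : _ = 0) ?addr0 //.
by rewrite mulrC /unfold_coef -!mulrA fps_coefXnM_small.
Qed.
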